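(* Let $\{\alpha_n\}_{n\ge1},\{\beta_n\}_{n\ge1}\subset\mathbb C$ and let $p_n(z)=P_n^{(\alpha_n,\beta_n)}(z)$ (assumed to be of degree $n$). Suppose that (a) the limits $A=\lim_{n\to\infty}\alpha_n/n$ and $B=\lim_{n\to\infty}\beta_n/n$ exist and $1+A+B\neq 0$; (b) the sequence $\{\mu_n\}$ of root-counting measures of the $p_n$ converges weakly to a probability measure $\mu$ with compact support in $\mathbb C$. Then the Cauchy transform $\mathcal C_\mu$ satisfies, for Lebesgue-almost every $z\in\mathbb C$, the quadratic equation $$(1-z^2)\,\mathcal C_\mu(z)^2-\big((A+B)z+A-B\big)\,\mathcal C_\mu(z)+A+B+1=0.$$
   Context: For complex $\alpha,\beta$ and integer $n\ge0$, the Jacobi polynomial is $P_n^{(\alpha,\beta)}(z)=2^{-n}\sum_{k=0}^n\binom{n+\alpha}{n-k}\binom{n+\beta}{k}(z-1)^k(z+1)^{n-k}$, where $\binom{\gamma}{k}=\gamma(\gamma-1)\cdots(\gamma-k+1)/k!$. For a polynomial $p$ of degree $n$ with roots $\xi_1,\dots,\xi_n$ (with multiplicity), its root-counting measure is $\mu_p=\frac1n\sum_{i=1}^n\delta_{\xi_i}$. For a finite compactly supported Borel measure $\mu$ on $\mathbb C$, its Cauchy transform is $\mathcal C_\mu(z)=\int_{\mathbb C}\frac{d\mu(\xi)}{z-\xi}$ (defined almost everywhere). *)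

(* Defs.v *)
From HB Require Import structures.
From mathcomp Require Import all_boot all_order all_algebra.
From mathcomp Require Import all_classical all_reals all_analysis.
From mathcomp Require Import complex.

Set Implicit Arguments.
Unset Strict Implicit.
Unset Printing Implicit Defensive.
Import Order.TTheory GRing.Theory Num.Theory.
Import numFieldNormedType.Exports.
Local Open Scope classical_set_scope.
Local Open Scope ring_scope.

Section Defs.
Variable R : realType.
Local Notation C := (R[i]).

Definition gbinom (g : C) (k : nat) : C :=
  (\prod_(i < k) (g - i%:R)) / (k`!)%:R.

Definition jacobi (n : nat) (a b : C) : {poly C} :=
  (2 ^- n) *: \sum_(k < n.+1)
     (gbinom (n%:R + a) (n - k) * gbinom (n%:R + b) k) *:
       (('X - 1) ^+ k * ('X + 1) ^+ (n - k)).

Definition toR2 (z : C) : (R * R)%type := (complex.Re z, complex.Im z).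
Definition ofR2 (x : (R * R)%type) : C := Complex x.1 x.2.

(* the roots of a polynomial, listed with multiplicity *)
Definition roots (p : {poly C}) : seq C := sval (closed_field_poly_normal p).

Definition root_measure (p : {poly C}) : {measure set (R * R)%type -> \bar R} :=
  mscale ((size (roots p))%:R^-1)%:nng
    (msum (fun i => @dirac _ (R * R)%type (toR2 (roots p)`_i) R) (size (roots p))).

Definition weak_cvg (mus : nat -> set (R * R)%type -> \bar R)
    (mu : set (R * R)%type -> \bar R) : Prop :=
  forall f : (R * R)%type -> R, continuous f ->
    (exists M : R, forall x, `|f x| <= M) ->
    (fun n => (\int[mus n]_x (f x)%:E)%E) @ \oo --> (\int[mu]_x (f x)%:E)%E.

Definition cauchy_defined (mu : {measure set (R * R)%type -> \bar R}) (z : C) : Prop :=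
  mu.-integrable setT (fun xi => (complex.Re ((z - ofR2 xi)^-1))%:E) /\
  mu.-integrable setT (fun xi => (complex.Im ((z - ofR2 xi)^-1))%:E).

Definition cauchy_transform (mu : {measure set (R * R)%type -> \bar R}) (z : C) : C :=
  Complex (Rintegral mu setT (fun xi => complex.Re ((z - ofR2 xi)^-1)))
  (Rintegral mu setT (fun xi => complex.Im ((z - ofR2 xi)^-1))).

Definition ccvg (u : nat -> C) (l : C) : Prop :=
  (fun n => complex.Re (u n)) @ \oo --> complex.Re l /\
  (fun n => complex.Im (u n)) @ \oo --> complex.Im l.

End Defs.

(* Main.v *)
Require Import Defs.
From HB Require Import structures.
From mathcomp Require Import all_boot all_order all_algebra.
From mathcomp Require Import all_classical all_reals all_analysis.
From mathcomp Require Import measurable_realfun complex.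
From mathcomp Require Import ring lra zify.
(* With F_n = p_n'/(n p_n) the Cauchy transform of mu_n and
   D_n = n^-2 * sum_i (z - xi_i)^-2, one has p_n''/p_n = n^2 (F_n^2 - D_n), so the
   Jacobi differential equation becomes, off the roots, a Riccati relation whose
   coefficients converge to those of the quadratic equation.  It remains to find, for
   almost every z, a subsequence along which F_n(z) -> C_mu(z) and D_n(z) -> 0.

   Fix a kernel V comparable to |w|^(-3/2) near 0.  The averages
   W_n(z) = n^-1 * sum_i V(z - xi_i) have the same integral over the plane for all n,
   so liminf W_n(z) is finite for almost every z by Fatou.  At such a z, along a
   subsequence with W_n(z) <= M: the error made in truncating 1/w at |w| < eps is
   O(sqrt(eps) M) uniformly in n, and weak convergence handles the truncated kernel,
   hence F_n(z) -> C_mu(z); and V(z - xi_i) <= n M for each i gives D_n(z) -> 0. *)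

Set Implicit Arguments.
Unset Strict Implicit.
Import Order.TTheory GRing.Theory Num.Theory.
Import numFieldNormedType.Exports.
Local Open Scope classical_set_scope.
Local Open Scope ring_scope.

(** * The Jacobi differential equation *)

Section Jacobi.
Variable R : realType.
Local Notation C := R[i].

Lemma gbinomS (g : C) (k : nat) : gbinom g k.+1 * k.+1%:R = gbinom g k * (g - k%:R).
Proof.
rewrite /gbinom big_ord_recr /= factS natrM invfM.
have k1 : (k.+1%:R : C) != 0 by rewrite pnatr_eq0.
have kf : ((k`!)%:R : C) != 0 by rewrite pnatr_eq0 -lt0n fact_gt0.
by field; rewrite ?k1 ?kf /= -?natr1 ?k1.
Qed.

Definition jcoef (n : nat) (a b : C) (k : nat) : C :=
  gbinom (n%:R + a) (n - k) * gbinom (n%:R + b) k.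

(** Two applications of [gbinomS], one per binomial factor. The product form avoids dividing by
    [k.+1%:R + a], which may vanish for complex [a]. *)
Lemma jcoefS (n : nat) (a b : C) (k : nat) : (k < n)%N ->
  jcoef n a b k.+1 * (k.+1%:R * (k.+1%:R + a)) =
  jcoef n a b k * ((n - k)%:R * (n%:R + b - k%:R)).
Proof.
move=> kn; rewrite /jcoef.
have e : (n - k = (n - k.+1).+1)%N by rewrite -subSn.
have := gbinomS (n%:R + a) (n - k.+1); rewrite -e => H1.
have H2 := gbinomS (n%:R + b) k.
rewrite (natrB _ kn) in H1.
have -> : gbinom (n%:R + a) (n - k.+1) * gbinom (n%:R + b) k.+1 *
   (k.+1%:R * (k.+1%:R + a)) = (gbinom (n%:R + b) k.+1 * k.+1%:R) *
   (gbinom (n%:R + a) (n - k.+1) * (n%:R + a - (n%:R - k.+1%:R))) by ring.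
by rewrite H2 -H1; ring.
Qed.

Definition jterm (n k : nat) : {poly C} := ('X - 1) ^+ k * ('X + 1) ^+ (n - k).

Lemma derivXn1 (e : {poly C}) (k : nat) : e^`() = 0 ->
  (('X + e) ^+ k)^`() = (k%:R) * ('X + e) ^+ k.-1.
Proof. by move=> e0; rewrite deriv_exp derivD derivX e0 addr0 mul1r mulr_natl. Qed.

(** The Jacobi operator is tridiagonal on the products [jterm n k], with off-diagonal entries equal
    to the factors in [jcoefS]. The out-of-range neighbours at [k = 0] and [k = n] carry the
    coefficient 0. *)
Lemma jterm_ode (n k : nat) (a b : C) : (k <= n)%N ->
  (1 - 'X ^+ 2) * (jterm n k)^`()^`()
  + ((b - a)%:P - (a + b + 2)%:P * 'X) * (jterm n k)^`()
  + (n%:R * (n%:R + a + b + 1))%:P * jterm n k =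
  ((n - k)%:R * (n%:R + b - k%:R) + k%:R * (k%:R + a))%:P * jterm n k
  - (k%:R * (k%:R + a))%:P * jterm n k.-1
  - ((n - k)%:R * (n%:R + b - k%:R))%:P * jterm n k.+1.
Proof.
move=> kn; rewrite -(subnK kn); move: (n - k)%N => m {n kn}.
rewrite /jterm addnK natrD.
have -> : (m + k - k.+1)%N = m.-1 by rewrite subnS addnK.
have -> : (m + k - k.-1)%N = (if k is 0 then m else m.+1) by case: k => [|k]; lia.
have d1 : (1 : {poly C})^`() = 0 by rewrite derivC.
have d2 : (- 1 : {poly C})^`() = 0 by rewrite derivN d1 oppr0.
have dn j : ((j%:R : {poly C}))^`() = 0 by rewrite -polyC_natr derivC.
rewrite !derivM !derivXn1 // !derivD !derivM !dn !derivXn1 // !mul0r !add0r.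
rewrite !polyCD !polyCN !polyCM !polyCD !polyCN !polyC_natr !polyC1.
move: (a%:P) (b%:P) => a' b'.
(* Two derivatives lower each exponent by at most 2, with predecessors truncated at 0; exponents 0
   and 1 are therefore treated apart. *)
case: k => [|[|k]]; case: m => [|[|m]] /=; rewrite ?exprS ?expr0; ring.
Qed.

(* By jcoefS, the two shifted sums produced by jterm_ode cancel the diagonal one. *)
Lemma jacobi_ode (n : nat) (a b : C) : let p := jacobi n a b in
  (1 - 'X ^+ 2) * p^`()^`()
  + ((b - a)%:P - (a + b + 2)%:P * 'X) * p^`()
  + (n%:R * (n%:R + a + b + 1))%:P * p = 0.
Proof.
rewrite /= /jacobi.
set s := \sum_(k < n.+1) _.
pose L (q : {poly C}) := (1 - 'X ^+ 2) * q^`()^`()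
  + ((b - a)%:P - (a + b + 2)%:P * 'X) * q^`()
  + (n%:R * (n%:R + a + b + 1))%:P * q.
have LZ c q : L (c *: q) = c *: L q.
  by rewrite /L !derivZ -!scalerAr -!scalerDr.
have LD q r : L (q + r) = L q + L r by rewrite /L !derivD; ring.
have L0 : L 0 = 0 by rewrite -(scale0r 0) LZ !scale0r.
rewrite -/(L (2 ^- n *: s)) LZ.
suff -> : L s = 0 by rewrite scaler0.
rewrite /s (big_morph _ LD L0).
under eq_bigr => k _ do rewrite -/(jterm n k) -/(jcoef n a b k) LZ.
under eq_bigr => k _ do rewrite /L jterm_ode -1?ltnS //.
under eq_bigr => k _ do rewrite !scalerBr.
pose E k := (jcoef n a b k * ((n - k)%:R * (n%:R + b - k%:R))) *: jterm n k.
pose F k := (jcoef n a b k * (k%:R * (k%:R + a))) *: jterm n k.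
have e1 : \sum_(k < n.+1) jcoef n a b k *: (((n - k)%:R * (n%:R + b - k%:R)
    + k%:R * (k%:R + a))%:P * jterm n k) = \sum_(k < n.+1) E k + \sum_(k < n.+1) F k.
  by rewrite -big_split; apply: eq_bigr => k _; rewrite mul_polyC scalerA mulrDr scalerDl.
have e2 : \sum_(k < n.+1) jcoef n a b k *: ((k%:R * (k%:R + a))%:P * jterm n k.-1)
    = \sum_(k < n.+1) E k.
  rewrite big_ord_recl mul0r mul0r scaler0 add0r big_ord_recr /=.
  rewrite [E n]/E subnn mul0r mulr0 scale0r addr0; apply: eq_bigr => k _.
  by rewrite /E mul_polyC scalerA /bump /= add1n -jcoefS.
have e3 : \sum_(k < n.+1) jcoef n a b k *: (((n - k)%:R * (n%:R + b - k%:R))%:P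
    * jterm n k.+1) = \sum_(k < n.+1) F k.
  rewrite big_ord_recr /= subnn !mul0r scaler0 addr0 big_ord_recl /=.
  rewrite [F 0%N]/F mul0r mulr0 scale0r add0r; apply: eq_bigr => k _.
  by rewrite /F mul_polyC scalerA /bump /= add1n jcoefS.
by rewrite !sumrB e1 e2 e3; ring.
Qed.

(** Logarithmic differentiation: P'/P = S1 and (P'/P)' = - S2. Induction on the list takes care of
    multiplicities. *)
Lemma deriv_prod (r : seq C) (z : C) : z \notin r ->
  let P := \prod_(x <- r) ('X - x%:P) in
  let S1 := \sum_(x <- r) (z - x)^-1 in
  let S2 := \sum_(x <- r) (z - x)^-1 ^+ 2 in
  [/\ P.[z] != 0, P^`().[z] = P.[z] * S1 & P^`()^`().[z] = P.[z] * (S1 ^+ 2 - S2)].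
Proof.
elim: r => [_|x r IH].
  by rewrite /= !big_nil !derivC !hornerC; split; rewrite ?hornerE ?oner_neq0 //; ring.
rewrite inE negb_or => /andP[zx zr].
have /= [P0 P1 P2] := IH zr.
have w0 : z - x != 0 by rewrite subr_eq0.
rewrite /= !big_cons !derivM !derivXsubC !mul1r !derivD !derivM derivXsubC !mul1r.
rewrite !(hornerD, hornerM, hornerN, hornerX, hornerC) P1 P2; split.
- by rewrite mulf_neq0.
- by field.
- by field.
Qed.

Lemma roots_size (p : {poly C}) (n : nat) : size p = n.+1 -> size (Defs.roots p) = n.
Proof.
rewrite /Defs.roots; case: closed_field_poly_normal => r /= e se.
have l0 : lead_coef p != 0 by rewrite lead_coef_eq0 -size_poly_eq0 se.
by move: se; rewrite e size_scale // size_prod_XsubC => -[].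
Qed.

(** The differential equation at [z], divided by p(z), with p'/p and p''/p taken from [deriv_prod];
    the leading coefficient cancels. *)
Lemma jacobi_riccati (n : nat) (a b z : C) : let p := jacobi n a b in
  size p = n.+1 -> z \notin Defs.roots p ->
  let S1 := \sum_(x <- Defs.roots p) (z - x)^-1 in
  let S2 := \sum_(x <- Defs.roots p) (z - x)^-1 ^+ 2 in
  (1 - z ^+ 2) * (S1 ^+ 2 - S2) + (b - a - (a + b + 2) * z) * S1
   + n%:R * (n%:R + a + b + 1) = 0.
Proof.
move=> p sp zr S1 S2.
have := jacobi_ode n a b; rewrite /= -/p => /(congr1 (horner^~ z)).
have p0 : lead_coef p != 0 by rewrite lead_coef_eq0 -size_poly_eq0 sp.
have /= [P0 P1 P2] := deriv_prod zr.
have e : p = lead_coef p *: \prod_(x <- Defs.roots p) ('X - x%:P).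
  by rewrite /Defs.roots; case: closed_field_poly_normal.
have -> : p^`()^`() = lead_coef p *: (\prod_(x <- Defs.roots p) ('X - x%:P))^`()^`().
  by rewrite [in LHS]e !derivZ.
have -> : p^`() = lead_coef p *: (\prod_(x <- Defs.roots p) ('X - x%:P))^`().
  by rewrite [in LHS]e !derivZ.
have -> : (n%:R * (n%:R + a + b + 1))%:P * p = (n%:R * (n%:R + a + b + 1))%:P *
    (lead_coef p *: \prod_(x <- Defs.roots p) ('X - x%:P)).
  by rewrite -e.
rewrite !(hornerD, hornerN, hornerM, hornerZ, hornerC, hornerX, hornerXn) P1 P2 -/S1 -/S2.
set P := (\prod_(x <- _) _).[z] in P0 *.
move=> H.
apply: (mulfI p0); apply: (mulfI P0); rewrite !mulr0 -[RHS]H; ring.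
Qed.
End Jacobi.

(** * The Cauchy kernel and its truncations *)

Section Kernel.
Variable R : realType.
Implicit Types (x y v t : R) (k m : nat).

(* The real part of 1/(x + iy); the imaginary part is [- cauchy_kernel y x].  At
   x = y = 0 this is 0, and so are its truncations below, so a possible atom of the
   limit measure at the evaluation point never contributes. *)
Definition cauchy_kernel x y := x / (x ^+ 2 + y ^+ 2).
Definition trunc_kernel m x y := x / Num.max (x ^+ 2 + y ^+ 2) (16^-1 ^+ m).

(* All that is used of a bound v on the potential at x + iy; it forces
   |x + iy|^(-3/2) = O(1 + v) and, in particular, x + iy <> 0. *)
Definition dominates x y v := forall k, `|x| <= 4^-1 ^+ k -> `|y| <= 4^-1 ^+ k -> 8 ^+ k <= v.

Lemma sqn_ge0 x y : 0 <= x ^+ 2 + y ^+ 2.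
Proof. by rewrite addr_ge0 ?sqr_ge0. Qed.

Lemma exists_exp_gt x (c : R) : 2 <= c -> exists k, x < c ^+ k.
Proof.
move=> c2; exists (Num.bound x); apply: lt_le_trans (upper_nthrootP (leqnn _)) _.
by rewrite lerXn2r ?nnegrE //; lra.
Qed.

Lemma expr16V k : (4 ^+ k ^+ 2)^-1 = 16^-1 ^+ k :> R.
Proof. by rewrite -exprM mulnC exprM -exprVn; congr (_^-1 ^+ _); ring. Qed.

(** The origin satisfies the size conditions for every [k], and no real [v] bounds all the powers of
    8. *)
Lemma dominates_gt0 x y v : dominates x y v -> 0 < x ^+ 2 + y ^+ 2.
Proof.
move=> d; rewrite lt_def sqn_ge0 andbT; apply/eqP => /eqP.
rewrite paddr_eq0 ?sqr_ge0 // !sqrf_eq0 => /andP[/eqP x0 /eqP y0].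
have [k] := @exists_exp_gt v 8 ltac:(lra).
by rewrite ltNge d // ?x0 ?y0 normr0 exprn_ge0 // invr_ge0.
Qed.

(** Locates w = x + iy in a dyadic annulus: [k] is the least index with 4^-(k+1) <= |w|, and
    minimality gives |w| <= 4^-k. The kernel estimates below are read off from 8^k <= v on that
    annulus. *)
Lemma dominates_dyadic x y v : dominates x y v -> 1 <= x ^+ 2 + y ^+ 2 \/
  exists k, [/\ 16^-1 ^+ k.+1 <= x ^+ 2 + y ^+ 2,
    `|x| <= 4^-1 ^+ k, `|y| <= 4^-1 ^+ k & 8 ^+ k <= v].
Proof.
move=> d; have q0 := dominates_gt0 d.
have [q1|q1] := leP 1 (x ^+ 2 + y ^+ 2); [by left|right].
have e16 j : 16^-1 ^+ j = (4^-1 ^+ j) ^+ 2 :> R.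
  by rewrite -expr16V -!exprVn.
have ex : exists k, 16^-1 ^+ k.+1 <= x ^+ 2 + y ^+ 2.
  have [k hk] := @exists_exp_gt (x ^+ 2 + y ^+ 2)^-1 16 ltac:(lra).
  exists k; rewrite exprVn invf_ple ?posrE ?exprn_gt0 //.
  by rewrite (le_trans (ltW hk)) // ler_eXn2l // ltr1n.
have [k hk kmin] := ex_minnP ex; exists k.
have qk : x ^+ 2 + y ^+ 2 <= 16^-1 ^+ k.
  case: k {hk} kmin => [|k] kmin; first by rewrite expr0 ltW.
  by rewrite leNgt; apply/negP => /ltW /kmin; rewrite ltnn.
have xk : `|x| <= 4^-1 ^+ k.
  rewrite -(@ler_pXn2r _ 2) ?nnegrE ?exprn_ge0 ?invr_ge0 // -e16 real_normK ?num_real //.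
  by apply: le_trans qk; rewrite lerDl sqr_ge0.
have yk : `|y| <= 4^-1 ^+ k.
  rewrite -(@ler_pXn2r _ 2) ?nnegrE ?exprn_ge0 ?invr_ge0 // -e16 real_normK ?num_real //.
  by apply: le_trans qk; rewrite lerDr sqr_ge0.
by split => //; apply: d.
Qed.

Lemma cauchy_kernel_le x y c : 0 < c -> (c ^+ 2)^-1 <= x ^+ 2 + y ^+ 2 -> `|cauchy_kernel x y| <= c.
Proof.
move=> c0 h; have q0 : 0 < x ^+ 2 + y ^+ 2.
  by apply: lt_le_trans h; rewrite invr_gt0 exprn_gt0.
rewrite -(@ler_pXn2r _ 2) ?nnegrE ?(ltW c0) // real_normK ?num_real //.
rewrite /cauchy_kernel expr_div_n ler_pdivrMr ?exprn_gt0 //.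
have : 1 <= c ^+ 2 * (x ^+ 2 + y ^+ 2) by rewrite mulrC -ler_pdivrMr ?exprn_gt0 // div1r.
set q := _ + _ in q0 h *.
have : x ^+ 2 <= q by rewrite lerDl sqr_ge0.
move=> xq; nra.
Qed.

Lemma trunc_kernel_le m x y : `|trunc_kernel m x y| <= `|cauchy_kernel x y|.
Proof.
have [q0|q0] := ltP 0 (x ^+ 2 + y ^+ 2); last first.
  have : x ^+ 2 + y ^+ 2 == 0 by rewrite eq_le q0 sqn_ge0.
  rewrite paddr_eq0 ?sqr_ge0 // sqrf_eq0 => /andP[/eqP x0 _].
  by rewrite /trunc_kernel /cauchy_kernel x0 !mul0r.
have le : x ^+ 2 + y ^+ 2 <= Num.max (x ^+ 2 + y ^+ 2) (16^-1 ^+ m) by rewrite le_max lexx.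
have m0 := lt_le_trans q0 le.
rewrite /trunc_kernel /cauchy_kernel !normrM ler_wpM2l //.
rewrite gtr0_norm ?invr_gt0 // gtr0_norm ?invr_gt0 //.
by rewrite lef_pV2 ?posrE.
Qed.

Lemma trunc_kernel_near m x y :
  trunc_kernel m x y = cauchy_kernel x y \/ x ^+ 2 + y ^+ 2 < 16^-1 ^+ m.
Proof.
by rewrite /trunc_kernel; case: ltP => h; [right|left].
Qed.

(** On the k-th annulus 1/|w| <= 4^(k+1) <= 4 * 8^k <= 4 v; the summand 1 covers |w| >= 1. *)
Lemma dominates_kernel x y v : dominates x y v -> 0 <= v -> `|cauchy_kernel x y| <= 1 + 4 * v.
Proof.
move=> d v0; have [q1|[k [qk _ _ kv]]] := dominates_dyadic d.
  apply: (@le_trans _ _ 1); last by lra.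
  by apply: cauchy_kernel_le; rewrite // expr1n invr1.
apply: (@le_trans _ _ (4 ^+ k.+1)).
  apply: cauchy_kernel_le; rewrite ?exprn_gt0 //; apply: le_trans qk.
  by rewrite expr16V.
rewrite exprS; have : 4 ^+ k <= 8 ^+ k :> R by rewrite lerXn2r ?nnegrE //; lra.
lra.
Qed.

(** The kernels differ only for |w| < 4^-m, that is on annuli with k >= m, and there 4^(k+1) = 4 *
    2^-k * 8^k <= 4 * 2^-m * v. *)
Lemma dominates_trunc_error x y v m : dominates x y v -> 0 <= v ->
  `|cauchy_kernel x y - trunc_kernel m x y| <= 4 * 2^-1 ^+ m * v.
Proof.
move=> d v0; have [->|qm] := trunc_kernel_near m x y.
  by rewrite subrr normr0 !mulr_ge0 ?exprn_ge0 ?invr_ge0.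
have q0 := dominates_gt0 d.
have [q1|[k [qk _ _ kv]]] := dominates_dyadic d.
  suff : 16^-1 ^+ m <= 1 :> R by lra.
  by rewrite exprn_ile1 ?invr_ge0 // invf_le1 // ler1n.
have mk : (m <= k)%N.
  rewrite leqNgt; apply/negP => km.
  have c0 : 0 <= 16^-1 :> R by lra.
  have c1 : 16^-1 <= 1 :> R by lra.
  by have := lt_le_trans (le_lt_trans qk qm) (ler_wiXn2l c0 c1 km); rewrite ltxx.
apply: (@le_trans _ _ (4 ^+ k.+1)).
  apply: (@le_trans _ _ `|cauchy_kernel x y|); last first.
    apply: cauchy_kernel_le; rewrite ?exprn_gt0 //; apply: le_trans qk.
    by rewrite expr16V.
  rewrite /cauchy_kernel /trunc_kernel -mulrBr !normrM ler_wpM2l // ger0_norm.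
    by rewrite ger0_norm ?invr_ge0 ?sqn_ge0 // lerBlDr lerDl invr_ge0 le_max sqn_ge0.
  by rewrite subr_ge0 lef_pV2 ?posrE ?lt_max ?q0 // le_max lexx.
rewrite exprS -mulrA ler_pM2l // (_ : 4 = 2^-1 * 8); last by field.
rewrite exprMn ler_pM ?exprn_ge0 ?invr_ge0 //.
by rewrite ler_wiXn2l ?invr_ge0 // invf_le1 // ler1n.
Qed.

(* t stands for the square root of a bound on v, since 4^k <= 8^k <= v gives 2^k <= t. *)
Lemma dominates_inv_sqn x y v t : dominates x y v -> 0 <= v -> 0 <= t -> v <= t ^+ 2 ->
  (x ^+ 2 + y ^+ 2)^-1 <= 1 + 16 * v * t.
Proof.
move=> d v0 t0 vt; have q0 := dominates_gt0 d; have [q1|[k [qk _ _ kv]]] := dominates_dyadic d.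
  apply: (@le_trans _ _ 1); first by rewrite invf_le1.
  by rewrite lerDl !mulr_ge0.
apply: (@le_trans _ _ (16 ^+ k.+1)).
  by rewrite invf_ple ?posrE ?exprn_gt0 // -exprVn.
rewrite exprS (_ : 16 = 8 * 2); last by ring.
have tk : 2 ^+ k <= t.
  rewrite -(@ler_pXn2r _ 2) ?nnegrE ?exprn_ge0 //.
  apply: le_trans vt; apply: le_trans kv; rewrite -exprM mulnC exprM.
  by rewrite lerXn2r ?nnegrE ?exprn_ge0 //; lra.
rewrite exprMn.
have : 8 ^+ k * 2 ^+ k <= v * t by rewrite ler_pM ?exprn_ge0.
by nra.
Qed.

End Kernel.

(** * Convergence of averages of a singular kernel *)

Section Convergence.
Variable R : realType.
Local Notation T := (R * R)%type.

Definition avg (r : seq T) (f : T -> R) : R := (size r)%:R^-1 * \sum_(x <- r) f x.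

(** Only an inequality, since the average over the empty list is 0 ([0^-1 = 0]). *)
Lemma avg_cst_le (r : seq T) (c : R) : 0 <= c -> avg r (cst c) <= c.
Proof.
move=> c0; rewrite /avg big_const_seq count_predT iter_addr_0 -[X in _ * X]mulr_natl mulrA.
have [->|s0] := eqVneq (size r) 0%N; first by rewrite invr0 !mul0r.
by rewrite mulVf ?mul1r // pnatr_eq0.
Qed.

Lemma avg_le (r : seq T) (f g : T -> R) : {in r, forall x, f x <= g x} -> avg r f <= avg r g.
Proof.
move=> fg; rewrite /avg ler_wpM2l ?invr_ge0 // !big_seq.
exact: ler_sum.
Qed.

Lemma avgD (r : seq T) (f g : T -> R) : avg r (fun x => f x + g x) = avg r f + avg r g.
Proof. by rewrite /avg big_split mulrDr. Qed.

Lemma avgZ (r : seq T) (f : T -> R) (c : R) : avg r (fun x => c * f x) = c * avg r f.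
Proof. by rewrite /avg -mulr_sumr mulrCA. Qed.

Lemma avgB_norm (r : seq T) (f g : T -> R) : `|avg r f - avg r g| <= avg r (fun x => `|f x - g x|).
Proof.
rewrite /avg -mulrBr -sumrB normrM ger0_norm ?invr_ge0 // ler_wpM2l ?invr_ge0 //.
exact: ler_norm_sum.
Qed.

Definition bounded_cont (f : T -> R) :=
  [/\ measurable_fun setT f, continuous f & exists M, forall x, `|f x| <= M].

Lemma bounded_cont_norm (f : T -> R) : bounded_cont f -> bounded_cont (fun x => `|f x|).
Proof.
move=> [mf cf [B hB]]; split.
- exact: measurableT_comp.
- by move=> x; apply: cvg_norm; exact: cf.
- by exists B => x; rewrite normr_id.
Qed.

Lemma bounded_cont_integrable (mu : probability T R) (f : T -> R) :
  bounded_cont f -> mu.-integrable setT (EFin \o f).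
Proof.
move=> [mf _ [B hB]]; apply: measurable_bounded_integrable => //.
  by rewrite -ge0_fin_numE // fin_num_measure.
exists B; split; first exact: num_real.
by move=> y By x _; exact: le_trans (hB x) (ltW By).
Qed.

Lemma limn_einf_le (u : (\bar R)^nat) (c : \bar R) :
  (forall n, (u n <= c)%E) -> (limn_einf u <= c)%E.
Proof.
move=> uc; rewrite limn_einf_lim; apply: lime_le; first exact: is_cvg_einfs.
apply: nearW => n; apply: le_trans (uc n).
by apply: ereal_inf_lbound; exists n => /=.
Qed.

(* Integrability of k comes from Fatou, the integrals of |km m| being limits of averages
   bounded by 1 + 4 M; then k is replaced by km m on both sides, uniformly in j. *)
Lemma singular_average_cvg (mu : probability T R) (r : nat -> seq T) (v : nat -> T -> R)
    (M : R) (k : T -> R) (km : nat -> T -> R) :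
  (forall f, bounded_cont f -> avg (r j) f @[j --> \oo] --> Rintegral mu setT f) ->
  0 <= M ->
  (forall j, avg (r j) (v j) <= M) ->
  (forall m, bounded_cont (km m)) ->
  (forall m x, `|km m x| <= `|k x|) ->
  (forall x, km m x @[m --> \oo] --> k x) ->
  (forall j, {in r j, forall x, `|k x| <= 1 + 4 * v j x}) ->
  (forall j m, {in r j, forall x, `|k x - km m x| <= 4 * 2^-1 ^+ m * v j x}) ->
  mu.-integrable setT (EFin \o k) /\
  avg (r j) k @[j --> \oo] --> Rintegral mu setT k.
Proof.
move=> wc M0 vM bc kmk cv kv kmv.
have mkm m : measurable_fun setT (km m) by case: (bc m).
have mk : measurable_fun setT k.
  by apply: (@measurable_fun_cvg _ _ _ setT km k) => // x _; exact: cv.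
have bca m := bounded_cont_norm (bc m).
have Ile m : Rintegral mu setT (fun x => `|km m x|) <= 1 + 4 * M.
  apply: (cvgr_to_le (wc _ (bca m))); apply: nearW => j.
  have le1 : avg (r j) (fun x => `|km m x|) <= avg (r j) (fun x => 1 + 4 * v j x).
    by apply: avg_le => x xr; apply: le_trans (kmk m x) _; exact: kv xr.
  apply: (le_trans le1); rewrite avgD avgZ lerD //; first exact: avg_cst_le.
  by rewrite ler_pM2l.
have ik : mu.-integrable setT (EFin \o k).
  apply/integrableP; split; first exact/measurable_EFinP.
  apply: (@le_lt_trans _ _ (1 + 4 * M)%:E); last exact: ltry.
  have -> : (\int[mu]_x `|(EFin \o k) x| = \int[mu]_x limn_einf (fun m => (`|km m x|)%:E))%E.
    apply: eq_integral => x _; symmetry.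
    apply: (@cvg_limn_einf_sup _ _ (`|k x|)%:E _).1.
    apply: cvg_EFin; first by apply: nearW.
    by apply: cvg_norm; exact: cv.
  apply: le_trans (fatou mu measurableT _ _) _.
  - by move=> m; apply/measurable_EFinP; case: (bca m).
  - by move=> m x _; rewrite lee_fin.
  - apply: limn_einf_le => m.
    rewrite -(fineK (integrable_fin_num measurableT (bounded_cont_integrable mu (bca m)))).
    by rewrite lee_fin; exact: Ile.
split => //.
have kmcv : Rintegral mu setT (km m) @[m --> \oo] --> Rintegral mu setT k.
  have [_ _ h] := @dominated_convergence _ _ _ mu setT measurableT
    (fun m => EFin \o km m) (EFin \o k) (fun x => (`|k x|)%:E)
    ltac:(move=> m; exact/measurable_EFinP) ltac:(exact/measurable_EFinP)
    ltac:(apply: aeW => x _; apply: cvg_EFin; [exact: nearW | exact: cv])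
    (integrable_abse ik)
    ltac:(apply: aeW => x m _; rewrite lee_fin; exact: kmk).
  apply: fine_cvg; rewrite /Rintegral fineK //; exact: integrable_fin_num.
apply/cvgrPdist_le => e e0.
have e30 : 0 < e / 3 by lra.
have e4 : (fun m => 4 * M * 2^-1 ^+ m) @ \oo --> (0 : R).
  rewrite -(mulr0 (4 * M)); apply: cvgMr.
  by apply: cvg_expr; rewrite ger0_norm //; lra.
(* The truncation level [m] is fixed first, making both truncation errors small; weak convergence is
   then used for the single function [km m]. *)
have [m [hm1 hm2]] : exists m, `|Rintegral mu setT k - Rintegral mu setT (km m)| <= e / 3 /\
    4 * M * 2^-1 ^+ m <= e / 3.
  have /cvgrPdist_le/(_ _ e30) n1 := kmcv.
  have n2 := @cvgr_le _ _ _ _ _ _ e4 _ e30.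
  by have [m hm] := filter_ex (filterI n1 (n2 _)); exists m.
have /cvgrPdist_le/(_ _ e30) n3 := wc _ (bc m).
apply: filterS n3 => j hj.
have hk : `|avg (r j) k - avg (r j) (km m)| <= e / 3.
  apply: le_trans (avgB_norm _ _ _) _.
  apply: le_trans (avg_le (kmv j m)) _; rewrite avgZ.
  apply: le_trans hm2; rewrite mulrAC ler_wpM2r ?exprn_ge0 ?invr_ge0 //.
  by rewrite ler_pM2l.
move: hm1 hj hk; rewrite !ler_norml; lra.
Qed.

End Convergence.

(** * The dyadic potential *)

Section Potential.
Variable R : realType.
Local Notation T := (R * R)%type.
Local Notation leb2 := (@lebesgue_measure R \x @lebesgue_measure R)%E.

Definition square (c : T) (k : nat) : set T :=
  `[c.1 - 4^-1 ^+ k, c.1 + 4^-1 ^+ k] `*` `[c.2 - 4^-1 ^+ k, c.2 + 4^-1 ^+ k].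

(* Comparable to |z - c|^(-3/2) near c, and +oo at c. *)
Definition pot (c z : T) : \bar R := (\sum_(0 <= k <oo) (8 ^+ k * \1_(square c k) z)%:E)%E.

Lemma measurable_square (c : T) (k : nat) : measurable (square c k).
Proof. by apply: measurableX; exact: measurable_itv. Qed.

Lemma pot_ge0 (c z : T) : (0 <= pot c z)%E.
Proof. by apply: nneseries_ge0 => k _ _; rewrite lee_fin mulr_ge0 ?exprn_ge0. Qed.

Lemma measurable_pot (c : T) : measurable_fun setT (pot c).
Proof.
apply: ge0_emeasurable_sum => [k z _ _|k _]; first by rewrite lee_fin mulr_ge0 ?exprn_ge0.
apply/measurable_EFinP; apply: measurable_funM => //.
by apply: measurable_indic; exact: measurable_square.
Qed.

Lemma leb2_square (c : T) (k : nat) : leb2 (square c k) = (4 * 16^-1 ^+ k)%:E.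
Proof.
have e0 : 0 < 4^-1 ^+ k :> R by rewrite exprn_gt0 ?invr_gt0.
rewrite /square product_measure1E; [|exact: measurable_itv..].
have h (a : R) : lebesgue_measure `[a - 4^-1 ^+ k, a + 4^-1 ^+ k] = (2 * 4^-1 ^+ k)%:E.
  rewrite lebesgue_measure_itv /= lte_fin (_ : _ < _); last by lra.
  by rewrite -EFinB; congr EFin; ring.
transitivity ((2 * 4^-1 ^+ k)%:E * (2 * 4^-1 ^+ k)%:E : \bar R)%E.
  by congr (_ * _)%E; exact: h.
rewrite -EFinM (_ : 16^-1 = 4^-1 * 4^-1); last by field.
by rewrite exprMn; congr EFin; ring.
Qed.

(** The k-th term integrates to 8^k * 4 * 16^-k = 4 * 2^-k. The ratio 8 lies between 4, the growth
    of 1/|w|, and 16, the decay of the areas: [pot] dominates the Cauchy kernel and stays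
    integrable. *)
Lemma integral_pot (c : T) : (\int[leb2]_z pot c z = 8%:E)%E.
Proof.
rewrite /pot integral_nneseries //; last first.
  move=> k; apply/measurable_EFinP; apply: measurable_funM => //.
  by apply: measurable_indic; exact: measurable_square.
have h k : (\int[leb2]_z (8 ^+ k * \1_(square c k) z)%:E = (4 * 2^-1 ^+ k)%:E)%E.
  under eq_integral => z _ do rewrite EFinM.
  rewrite ge0_integralZl_EFin ?exprn_ge0 //; last first.
    by apply/measurable_EFinP; apply: measurable_indic; exact: measurable_square.
  rewrite integral_indic ?setIT //; last exact: measurable_square.
  rewrite [X in (_ * X)%E](leb2_square c k) -EFinM (_ : 2^-1 = 8 * 16^-1); last by field.
  by rewrite exprMn; congr EFin; ring.
under eq_eseriesr => k _ do rewrite h.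
apply/cvg_lim => //; apply: cvg_EFin; first by apply: nearW => n; rewrite sumEFin.
have := @cvg_geometric_series R 4 2^-1.
rewrite ger0_norm ?invr_ge0 // => /(_ ltac:(lra)).
rewrite (_ : 4 / (1 - 2^-1) = 8); last by field.
by apply: cvg_trans; apply: near_eq_cvg; apply: nearW => n /=; rewrite sumEFin.
Qed.

(** If both coordinates are at most 4^-k in size, [z] lies in the k-th square, whose term alone is
    8^k. *)
Lemma pot_dominates (c z : T) (v : R) : (pot c z <= v%:E)%E -> dominates (z.1 - c.1) (z.2 - c.2) v.
Proof.
move=> h k hx hy; rewrite -lee_fin; apply: le_trans h.
have p0 j : xpredT j -> (0 <= (8 ^+ j * \1_(square c j) z : R)%:E)%E.
  by rewrite lee_fin mulr_ge0 ?exprn_ge0.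
rewrite /pot (@nneseriesD1 _ _ k _ p0) //.
have -> : \1_(square c k) z = 1 :> R.
  rewrite indicE mem_set //; move: hx hy; rewrite !ler_norml => /andP[? ?] /andP[? ?].
  by split; rewrite /= in_itv /=; apply/andP; split; lra.
rewrite mulr1 leeDl //; apply: nneseries_ge0 => j _ _.
by rewrite lee_fin mulr_ge0 ?exprn_ge0.
Qed.

Definition avg_pot (r : seq T) (z : T) : \bar R :=
  (((size r)%:R^-1)%:E * \sum_(c <- r) pot c z)%E.

Lemma measurable_avg_pot (r : seq T) : measurable_fun setT (avg_pot r).
Proof.
apply: measurable_funeM; apply: emeasurable_sum => c; exact: measurable_pot.
Qed.

Lemma avg_pot_ge0 (r : seq T) (z : T) : (0 <= avg_pot r z)%E.
Proof.
rewrite mule_ge0 ?lee_fin ?invr_ge0 //; apply: sume_ge0 => c _; exact: pot_ge0.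
Qed.

Lemma integral_avg_pot (r : seq T) : (\int[leb2]_z avg_pot r z <= 8%:E)%E.
Proof.
rewrite /avg_pot ge0_integralZl_EFin ?invr_ge0 //; last first.
- by apply: emeasurable_sum => c; exact: measurable_pot.
- by move=> z _; apply: sume_ge0 => c _; exact: pot_ge0.
rewrite ge0_integral_sum //; [|by move=> c; exact: measurable_pot|by move=> c z _; exact: pot_ge0].
under eq_bigr => c _ do rewrite integral_pot.
rewrite sumEFin -EFinM lee_fin big_const_seq count_predT iter_addr_0 -[X in _ * X]mulr_natl mulrA.
have [->|s0] := eqVneq (size r) 0%N; first by rewrite invr0 !mul0r.
by rewrite mulVf ?mul1r // pnatr_eq0.
Qed.

(** The lower limit has integral at most 8 by Fatou, so it is finite almost everywhere. The infimum
    over any tail is at most the lower limit, so each tail has a term below that limit plus 1. *)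
Lemma ae_frequently_bounded (r : nat -> seq T) :
  {ae leb2, forall z, exists2 M : R, 0 <= M &
     forall N, exists2 n, (N <= n)%N & (avg_pot (r n) z <= M%:E)%E}.
Proof.
pose L z := limn_einf (fun n => avg_pot (r n) z).
have einf_le z n : (einfs (fun n => avg_pot (r n) z) n <= L z)%E.
  rewrite /L limn_einf_lim (cvg_lim _ (@cvg_einfs_sup _ _)) //.
  by apply: ereal_sup_ubound; exists n.
have L0 z : (0 <= L z)%E.
  apply: le_trans (einf_le z 0%N); apply: le_ereal_inf_tmp => _ [n _ <-].
  exact: avg_pot_ge0.
have mL : measurable_fun setT L.
  (* [limn_einf] unfolds to the opposite of a [limn_esup] of opposites. *)
  apply: measurableT_comp => //; apply: measurable_fun_limn_esup => n.
  by apply: measurableT_comp => //; exact: measurable_avg_pot.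
have iL : leb2.-integrable setT L.
  apply/integrableP; split => //.
  under eq_integral => z _ do rewrite gee0_abs //.
  apply: (@le_lt_trans _ _ 8%:E); last exact: ltry.
  apply: le_trans (fatou _ measurableT _ _) _.
  - by move=> n; exact: measurable_avg_pot.
  - by move=> n z _; exact: avg_pot_ge0.
  - by apply: limn_einf_le => n; exact: integral_avg_pot.
have := integrable_ae measurableT iL; apply: filterS => z /(_ I) Lf.
exists (fine (L z) + 1); first by rewrite addr_ge0 // fine_ge0.
move=> N.
have : (ereal_inf (sdrop (fun n => avg_pot (r n) z) N) < (fine (L z) + 1)%:E)%E.
  apply: le_lt_trans (einf_le z N) _.
  by rewrite -[ltLHS](fineK Lf) lte_fin ltrDl.
by move=> /ereal_inf_lt[_ [n /= Nn <-]] h; exists n => //; exact: ltW.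
Qed.
End Potential.

(** * Convergence of complex sequences *)

Section ComplexConvergence.
Variable R : realType.
Local Notation C := R[i].
Implicit Types (u v : nat -> C) (a b : C).

Lemma cReD a b : complex.Re (a + b) = complex.Re a + complex.Re b.
Proof. by case: a b => [? ?] []. Qed.
Lemma cImD a b : complex.Im (a + b) = complex.Im a + complex.Im b.
Proof. by case: a b => [? ?] []. Qed.
Lemma cReN a : complex.Re (- a) = - complex.Re a.
Proof. by case: a. Qed.
Lemma cImN a : complex.Im (- a) = - complex.Im a.
Proof. by case: a. Qed.
Lemma cReM a b : complex.Re (a * b) = complex.Re a * complex.Re b - complex.Im a * complex.Im b.
Proof. by case: a b => [? ?] []. Qed.
Lemma cImM a b : complex.Im (a * b) = complex.Re a * complex.Im b + complex.Im a * complex.Re b.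
Proof. by case: a b => [? ?] []. Qed.
Lemma cReV a : complex.Re a^-1 = cauchy_kernel (complex.Re a) (complex.Im a).
Proof. by case: a. Qed.
Lemma cImV a : complex.Im a^-1 = - cauchy_kernel (complex.Im a) (complex.Re a).
Proof. by case: a => x y; rewrite /cauchy_kernel addrC. Qed.
Lemma cRe_sum (I : Type) (r : seq I) (F : I -> C) :
  complex.Re (\sum_(i <- r) F i) = \sum_(i <- r) complex.Re (F i).
Proof. exact: (big_morph _ cReD). Qed.
Lemma cIm_sum (I : Type) (r : seq I) (F : I -> C) :
  complex.Im (\sum_(i <- r) F i) = \sum_(i <- r) complex.Im (F i).
Proof. exact: (big_morph _ cImD). Qed.

Lemma natC_inv n : (n%:R : C)^-1 = Complex (n%:R^-1) 0.
Proof.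
have -> : (n%:R : C) = (n%:R : R)%:C%C by rewrite rmorph_nat.
by rewrite -fmorphV.
Qed.

Lemma cRe_divn n a : complex.Re (n%:R^-1 * a) = n%:R^-1 * complex.Re a.
Proof. by rewrite natC_inv cReM /= mul0r subr0. Qed.
Lemma cIm_divn n a : complex.Im (n%:R^-1 * a) = n%:R^-1 * complex.Im a.
Proof. by rewrite natC_inv cImM /= mul0r addr0. Qed.

Lemma ccvg_cst a : ccvg (fun _ => a) a.
Proof. by split; exact: cvg_cst. Qed.

Lemma ccvgN u a : ccvg u a -> ccvg (fun n => - u n) (- a).
Proof.
move=> [h1 h2]; split; [rewrite cReN; under eq_fun do rewrite cReN
  | rewrite cImN; under eq_fun do rewrite cImN]; exact: cvgN.
Qed.

Lemma ccvgD u v a b : ccvg u a -> ccvg v b -> ccvg (fun n => u n + v n) (a + b).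
Proof.
move=> [h1 h2] [h3 h4]; split; [rewrite cReD; under eq_fun do rewrite cReD
  | rewrite cImD; under eq_fun do rewrite cImD]; exact: cvgD.
Qed.

Lemma ccvgB u v a b : ccvg u a -> ccvg v b -> ccvg (fun n => u n - v n) (a - b).
Proof. by move=> h1 h2; apply: ccvgD => //; exact: ccvgN. Qed.

Lemma ccvgM u v a b : ccvg u a -> ccvg v b -> ccvg (fun n => u n * v n) (a * b).
Proof.
move=> [h1 h2] [h3 h4]; split; [rewrite cReM; under eq_fun do rewrite cReM
  | rewrite cImM; under eq_fun do rewrite cImM].
  by apply: cvgB; exact: cvgM.
by apply: cvgD; exact: cvgM.
Qed.

Lemma ccvg_unique u a b : ccvg u a -> ccvg u b -> a = b.
Proof.
case: a b => [a1 a2] [b1 b2] [/= h1 h2] [/= h3 h4].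
by rewrite (cvg_unique _ h1 h3) // (cvg_unique _ h2 h4).
Qed.

(** The bound [j <= phi j] already makes [phi] tend to infinity, so monotonicity is not asked
    for. *)
Lemma ccvg_subseq u a (phi : nat -> nat) : (forall j, (j <= phi j)%N) ->
  ccvg u a -> ccvg (u \o phi) a.
Proof.
move=> hphi [h1 h2]; have c : phi @ \oo --> \oo.
  apply/cvgnyPge => N; near=> j; apply: leq_trans (hphi j); near: j.
  exact: nbhs_infty_ge.
split.
- exact: (@cvg_comp _ _ _ phi (fun n => complex.Re (u n)) _ _ _ c h1).
- exact: (@cvg_comp _ _ _ phi (fun n => complex.Im (u n)) _ _ _ c h2).
Unshelve. all: by end_near. Qed.

End ComplexConvergence.

(** * Regularity and convergence of the truncated kernels *)

Section Regularised.
Variable R : realType.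
Local Notation T := (R * R)%type.

Lemma bounded_cont_trunc_kernel m (f g : T -> R) :
  measurable_fun setT f -> continuous f -> measurable_fun setT g -> continuous g ->
  bounded_cont (fun x => trunc_kernel m (f x) (g x)).
Proof.
move=> mf cf mg cg.
have e0 : 0 < 16^-1 ^+ m :> R by rewrite exprn_gt0 ?invr_gt0.
have d0 (x : R) : Num.max x (16^-1 ^+ m) != 0 by rewrite gt_eqF // lt_max e0 orbT.
have cinv : continuous (fun x : R => (Num.max x (16^-1 ^+ m))^-1).
  move=> x; apply: cvgV => //.
  apply: (@continuous_max _ _ (fun x : R => x) (fun=> 16^-1 ^+ m)); first exact: cvg_id.
  exact: cvg_cst.
split.
- apply: measurable_funM => //.
  apply: (measurableT_comp (continuous_measurable_fun cinv)).
  by apply: measurable_funD; exact: measurable_funX.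
- have cq : continuous (fun y => f y ^+ 2 + g y ^+ 2).
    by move=> y; apply: cvgD; [exact: (cvgM (cf y) (cf y))|exact: (cvgM (cg y) (cg y))].
  move=> x; apply: cvgM; first exact: cf.
  exact: (continuous_comp (cq x) (cinv _)).
(* With [d] the truncated denominator, |f|^2 <= d gives |f| <= 1 + d, hence |f| / d <= 1/d + 1 <=
   16^m + 1. *)
exists (16 ^+ m + 1) => x; rewrite /trunc_kernel.
set q := _ + _; set d := Num.max _ _.
have dg : 0 < d by rewrite lt_max e0 orbT.
have qd : q <= d by rewrite le_max lexx.
have fq : `|f x| <= 1 + d.
  have : `|f x| ^+ 2 <= d by rewrite real_normK ?num_real // (le_trans _ qd) // lerDl sqr_ge0.
  have := normr_ge0 (f x); move: `|f x| => y; nra.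
rewrite normrM normfV (gtr0_norm dg) ler_pdivrMr //; apply: le_trans fq _.
rewrite mulrDl mul1r lerD2r -ler_pdivrMl ?exprn_gt0 // mulr1 -exprVn.
by rewrite le_max lexx orbT.
Qed.

(** Away from 0 the sequence is eventually constant, the truncation being inactive once 16^-m <
    |w|^2; at 0 all the values are 0. *)
Lemma trunc_kernel_cvg (x y : R) : trunc_kernel m x y @[m --> \oo] --> cauchy_kernel x y.
Proof.
have [q0|q0] := ltP 0 (x ^+ 2 + y ^+ 2); last first.
  have : x ^+ 2 + y ^+ 2 == 0 by rewrite eq_le q0 sqn_ge0.
  rewrite paddr_eq0 ?sqr_ge0 // sqrf_eq0 => /andP[/eqP x0 _].
  have -> : (fun m => trunc_kernel m x y) = (fun=> cauchy_kernel x y).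
    by apply/funext => m; rewrite /trunc_kernel /cauchy_kernel x0 !mul0r.
  exact: cvg_cst.
have e : (16^-1 ^+ m @[m --> \oo] --> (0 : R)).
  by apply: cvg_expr; rewrite ger0_norm //; lra.
have h := @cvgr_lt _ _ _ _ _ _ e _ q0.
apply: cvg_near_cst; apply: filterS (h _) => m hm.
by case: (trunc_kernel_near m x y) => // /(lt_trans hm); rewrite ltxx.
Qed.

End Regularised.

(** * Passage to the limit *)

Section Empirical.
Variable R : realType.
Local Notation T := (R * R)%type.
Local Notation C := R[i].

(** The terms are nonnegative, so a finite sum makes each of them finite; real values can be used
    from here on. *)
Lemma avg_pot_fine (r : seq T) (z : T) (M : R) : size r != 0%N ->
  (avg_pot r z <= M%:E)%E ->
  {in r, forall c, pot c z = (fine (pot c z))%:E} /\ avg r (fun c => fine (pot c z)) <= M.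
Proof.
move=> r0 h.
have s0 : 0 < (size r)%:R :> R by rewrite ltr0n lt0n.
have le : (\sum_(c <- r) pot c z <= ((size r)%:R * M)%:E)%E.
  by rewrite EFinM -lee_pdivrMl.
have fin : {in r, forall c, pot c z = (fine (pot c z))%:E}.
  move=> c cr; rewrite fineK // ge0_fin_numE ?pot_ge0 //.
  apply: le_lt_trans (ltry ((size r)%:R * M)); apply: le_trans le.
  rewrite (big_rem c) //= leeDl // sume_ge0 // => d _; exact: pot_ge0.
split => //; rewrite /avg -lee_fin EFinM -sumEFin; apply: le_trans h.
rewrite /avg_pot le_eqVlt; apply/orP; left; apply/eqP; congr (_ * _)%E.
by apply: eq_big_seq => c cr; rewrite -fin.
Qed.

(** Nonnegative functions come first, where the integral passes through [mscale] and [msum]. The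
    positive and negative parts of [f] then have finite integrals, which can be subtracted. *)
Lemma integral_root_measure (p : {poly C}) (f : T -> R) : measurable_fun setT f ->
  (\int[root_measure p]_x (f x)%:E)%E = (avg (map (@toR2 R) (Defs.roots p)) f)%:E.
Proof.
move=> mf.
have ge0 (g : T -> R) : measurable_fun setT g -> (forall x, 0 <= g x) ->
  (\int[root_measure p]_x (g x)%:E)%E = (avg (map (@toR2 R) (Defs.roots p)) g)%:E.
  move=> mg g0; rewrite /root_measure.
  have mg' : measurable_fun setT (EFin \o g) by exact/measurable_EFinP.
  rewrite ge0_integral_mscale //; last by move=> x _; rewrite lee_fin.
  rewrite ge0_integral_measure_sum //; last by move=> x _; rewrite lee_fin.
  under eq_bigr => i _ do rewrite integral_dirac // diracT mul1e.
  rewrite sumEFin -EFinM /avg size_map big_map; congr (_ * _)%:E.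
  by rewrite (big_nth 0) big_mkord.
rewrite integralE funerpos funerneg.
rewrite (ge0 (f^\+)%R) ?(ge0 (f^\-)%R) //.
- rewrite -EFinB /avg -mulrBr -sumrB; congr (_ * _)%:E.
  by apply: eq_bigr => x _; rewrite -[in RHS](funrposBneg f).
- exact: measurable_funrneg.
- exact: measurable_funrpos.
Qed.

Lemma norm_squeeze0 (u w : nat -> R) : (forall j, `|w j| <= u j) ->
  u j @[j --> \oo] --> (0 : R) -> w j @[j --> \oo] --> (0 : R).
Proof.
move=> h u0; apply: (@squeeze_cvgr nat \oo _ R (fun j => - u j) u) => //.
- by apply: nearW => j; rewrite -ler_norml.
- by rewrite -oppr0; exact: cvgN.
Qed.

(** With n = [size (r j)], each value of [v j] on the list is at most n M. Taking t = sqrt(n M) in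
    [dominates_inv_sqn], the average is at most 1 + 16 t M, and division by n leaves 1/n + 16 M
    sqrt(M/n). *)
Lemma inv_sq_avg_cvg0 (a b M : R) (r : nat -> seq T) (v : nat -> T -> R) : 0 <= M ->
  (forall j, (j < size (r j))%N) ->
  (forall j, {in r j, forall x, 0 <= v j x}) ->
  (forall j, avg (r j) (v j) <= M) ->
  (forall j, {in r j, forall x, dominates (a - x.1) (b - x.2) (v j x)}) ->
  (size (r j))%:R^-1 * avg (r j) (fun x => ((a - x.1) ^+ 2 + (b - x.2) ^+ 2)^-1)
    @[j --> \oo] --> (0 : R).
Proof.
move=> M0 sr v0 vM hd.
pose n j : R := (size (r j))%:R.
have n0 j : 0 < n j by rewrite ltr0n (leq_ltn_trans _ (sr j)).
have nz j : n j != 0 by rewrite gt_eqF ?n0.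
have ncv : (n j)^-1 @[j --> \oo] --> (0 : R).
  apply: (@squeeze_cvgr nat \oo _ R (fun=> 0) (fun j => j.+1%:R^-1)).
  - apply: nearW => j; rewrite invr_ge0 (ltW (n0 j)) /= lef_pV2 ?posrE ?n0 ?ltr0n //.
    by rewrite /n ler_nat.
  - exact: cvg_cst.
  - exact: cvg_harmonic.
apply: (@squeeze_cvgr nat \oo _ R (fun=> 0) (fun j => (n j)^-1 + 16 * M * Num.sqrt (M * (n j)^-1))).
- apply: nearW => j; apply/andP; split.
    rewrite mulr_ge0 ?invr_ge0 ?ler0n // /avg mulr_ge0 ?invr_ge0 ?ler0n //.
    by apply: sumr_ge0 => x _; rewrite invr_ge0 sqn_ge0.
  (* This is sqrt(n M), written so that dividing by n yields sqrt(M/n) at once. *)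
  set t := n j * Num.sqrt (M * (n j)^-1).
  have t0 : 0 <= t by rewrite mulr_ge0 ?sqrtr_ge0 // ltW.
  have tE : t ^+ 2 = n j * M.
    rewrite /t exprMn sqr_sqrtr ?mulr_ge0 ?invr_ge0 ?(ltW (n0 j)) //.
    by field; exact: nz.
  have vt : {in r j, forall x, v j x <= t ^+ 2}.
    move=> x xr; rewrite tE -ler_pdivrMl //; apply: le_trans (vM j).
    rewrite /avg ler_pM2l ?invr_gt0 //.
    rewrite (big_rem x) //= lerDl big_seq; apply: sumr_ge0 => y yr.
    by apply: v0; exact: mem_rem yr.
  have le1 : avg (r j) (fun x => ((a - x.1) ^+ 2 + (b - x.2) ^+ 2)^-1) <=
      avg (r j) (fun x => 1 + 16 * t * v j x).
    apply: avg_le => x xr.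
    apply: le_trans (dominates_inv_sqn (hd j x xr) (v0 j x xr) t0 (vt x xr)) _.
    by rewrite mulrAC.
  have le2 : avg (r j) (fun x => 1 + 16 * t * v j x) <= 1 + 16 * t * M.
    rewrite avgD avgZ lerD //; first exact: avg_cst_le.
    by rewrite ler_wpM2l // mulr_ge0.
  apply: (@le_trans _ _ ((n j)^-1 * (1 + 16 * t * M))).
    by rewrite ler_wpM2l ?invr_ge0 ?ler0n // (le_trans le1).
  by rewrite le_eqVlt; apply/orP; left; apply/eqP; rewrite /t; field; exact: nz.
- exact: cvg_cst.
have h0 : M * (n j)^-1 @[j --> \oo] --> (0 : R).
  by rewrite -(mulr0 M); exact: cvgMr.
have h1 : Num.sqrt (M * (n j)^-1) @[j --> \oo] --> (0 : R).
  rewrite -(@sqrtr0 R).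
  exact: (@cvg_comp _ _ _ (fun j => M * (n j)^-1) Num.sqrt _ _ _ h0 (@sqrt_continuous R 0)).
have h2 : 16 * M * Num.sqrt (M * (n j)^-1) @[j --> \oo] --> (0 : R).
  by rewrite -(mulr0 (16 * M)); exact: cvgMr.
have := cvgD ncv h2; rewrite addr0; exact.
Qed.

End Empirical.

(** * The quadratic equation at a point where the potentials are frequently bounded *)

Section Limit.
Variable R : realType.
Local Notation T := (R * R)%type.
Local Notation C := R[i].

Lemma weak_cvg_avg (p : nat -> {poly C}) (mu : probability T R) (f : T -> R) :
  weak_cvg (fun n => root_measure (p n)) mu -> bounded_cont f ->
  avg (map (@toR2 R) (Defs.roots (p n))) f @[n --> \oo] --> Rintegral mu setT f.
Proof.
move=> wc bf; have [mf cf fb] := bf.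
have fin : (\int[mu]_x (f x)%:E)%E \is a fin_num.
  by apply: integrable_fin_num => //; exact: (bounded_cont_integrable mu bf).
have h : (fun n => \int[root_measure (p n)]_x (f x)%:E)%E @ \oo -->
    (fine (\int[mu]_x (f x)%:E)%E)%:E by rewrite fineK //; exact: wc.
have E : (fun n => \int[root_measure (p n)]_x (f x)%:E)%E =
    (fun n => (avg (map (@toR2 R) (Defs.roots (p n))) f)%:E).
  by apply/funext => n; rewrite integral_root_measure.
by rewrite E in h; exact: (fine_cvg h).
Qed.

(** The pointwise core: [z] is fixed, and the only information about it is the bound [M] along
    infinitely many indices. *)
Lemma jacobi_cauchy_eq (alpha beta : nat -> C) (A B : C) (mu : probability T R)
    (z : T) (M : R) :
  (forall n, (1 <= n)%N -> size (jacobi n (alpha n) (beta n)) = n.+1) ->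
  ccvg (fun n => alpha n / n%:R) A ->
  ccvg (fun n => beta n / n%:R) B ->
  weak_cvg (fun n => root_measure (jacobi n (alpha n) (beta n))) mu ->
  0 <= M ->
  (forall N, exists2 n, (N <= n)%N &
    (avg_pot (map (@toR2 R) (Defs.roots (jacobi n (alpha n) (beta n)))) z <= M%:E)%E) ->
  cauchy_defined mu (ofR2 z) /\
     (1 - ofR2 z ^+ 2) * cauchy_transform mu (ofR2 z) ^+ 2
       - ((A + B) * ofR2 z + A - B) * cauchy_transform mu (ofR2 z) + A + B + 1 = 0.
Proof.
move=> sz hA hB wc M0 freq.
pose p n := jacobi n (alpha n) (beta n).
pose rt n := map (@toR2 R) (Defs.roots (p n)).
(* The strict bound [j < phi j] gives both [0 < phi j] and [j < size (r j)]. *)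
have [phi hphi] : exists phi : nat -> nat, forall j,
    (j < phi j)%N /\ (avg_pot (rt (phi j)) z <= M%:E)%E.
  have h j : exists n, (j < n)%N /\ (avg_pot (rt n) z <= M%:E)%E.
    by have [n hn1 hn2] := freq j.+1; exists n.
  by exists (fun j => projT1 (cid (h j))) => j; exact: projT2 (cid (h j)).
have phi0 j : (0 < phi j)%N by apply: leq_ltn_trans (hphi j).1.
have szrt j : size (rt (phi j)) = phi j.
  by rewrite size_map; apply: roots_size; exact: sz.
have n0 j : ((phi j)%:R : C) != 0 by rewrite pnatr_eq0 -lt0n.
pose r j := rt (phi j).
pose v (j : nat) (x : T) := fine (pot x z).
have v0 j : {in r j, forall x, 0 <= v j x} by move=> x _; rewrite fine_ge0 ?pot_ge0.
have rv j : {in r j, forall x, pot x z = (v j x)%:E} /\ avg (r j) (v j) <= M.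
  by apply: avg_pot_fine (hphi j).2; rewrite szrt -lt0n.
have hd j : {in r j, forall x, dominates (z.1 - x.1) (z.2 - x.2) (v j x)}.
  by move=> x xr; apply: pot_dominates; rewrite ((rv j).1 x xr).
(* [dominates] is symmetric in the coordinates, so the imaginary part of 1/w is handled as a real
   part with the coordinates exchanged. *)
have hd' j : {in r j, forall x, dominates (z.2 - x.2) (z.1 - x.1) (v j x)}.
  by move=> x xr k h1 h2; exact: hd xr k h2 h1.
have phile j : (j <= phi j)%N by apply: ltnW; exact: (hphi j).1.
have wcr f : bounded_cont f -> avg (r j) f @[j --> \oo] --> Rintegral mu setT f.
  move=> bf; have c : phi @ \oo --> \oo.
    apply/cvgnyPge => N; near=> j; apply: leq_trans (phile j); near: j.
    exact: nbhs_infty_ge.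
  exact: (@cvg_comp _ _ _ phi (fun n => avg (rt n) f) _ _ _ c (weak_cvg_avg wc bf)).
have mx : measurable_fun setT (fun x : T => z.1 - x.1).
  by apply: measurable_funB => //; exact: measurable_fst.
have my : measurable_fun setT (fun x : T => z.2 - x.2).
  by apply: measurable_funB => //; exact: measurable_snd.
have cx : continuous (fun x : T => z.1 - x.1).
  by move=> x; apply: cvgB; [exact: cvg_cst|exact: cvg_fst].
have cy : continuous (fun x : T => z.2 - x.2).
  by move=> x; apply: cvgB; [exact: cvg_cst|exact: cvg_snd].
have [i1 c1] := singular_average_cvg (k := fun x => cauchy_kernel (z.1 - x.1) (z.2 - x.2))
  (km := fun m x => trunc_kernel m (z.1 - x.1) (z.2 - x.2)) wcr M0 (fun j => (rv j).2)
  (fun m => bounded_cont_trunc_kernel m mx cx my cy) (fun m x => trunc_kernel_le m _ _)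
  (fun x => @trunc_kernel_cvg R _ _) (fun j x xr => dominates_kernel (hd j x xr) (v0 j x xr))
  (fun j m x xr => dominates_trunc_error m (hd j x xr) (v0 j x xr)).
have [i2 c2] := singular_average_cvg (k := fun x => cauchy_kernel (z.2 - x.2) (z.1 - x.1))
  (km := fun m x => trunc_kernel m (z.2 - x.2) (z.1 - x.1)) wcr M0 (fun j => (rv j).2)
  (fun m => bounded_cont_trunc_kernel m my cy mx cx) (fun m x => trunc_kernel_le m _ _)
  (fun x => @trunc_kernel_cvg R _ _) (fun j x xr => dominates_kernel (hd' j x xr) (v0 j x xr))
  (fun j m x xr => dominates_trunc_error m (hd' j x xr) (v0 j x xr)).
have reE (x : C) : complex.Re (ofR2 z - x)^-1 = cauchy_kernel (z.1 - (toR2 x).1) (z.2 - (toR2 x).2).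
  by rewrite cReV cReD cImD cReN cImN.
have imE (x : C) : complex.Im (ofR2 z - x)^-1 =
    - cauchy_kernel (z.2 - (toR2 x).2) (z.1 - (toR2 x).1).
  by rewrite cImV cReD cImD cReN cImN.
have imI : (fun xi => complex.Im (ofR2 z - ofR2 xi)^-1) =
    (fun x : T => - cauchy_kernel (z.2 - x.2) (z.1 - x.1)).
  by apply/funext => x; rewrite imE.
have reI : (fun xi => complex.Re (ofR2 z - ofR2 xi)^-1) =
    (fun x : T => cauchy_kernel (z.1 - x.1) (z.2 - x.2)).
  by apply/funext => x; rewrite reE.
have imIE : Rintegral mu setT (fun x : T => - cauchy_kernel (z.2 - x.2) (z.1 - x.1)) =
    - Rintegral mu setT (fun x : T => cauchy_kernel (z.2 - x.2) (z.1 - x.1)).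
  under eq_Rintegral => x _ do rewrite -mulN1r.
  by rewrite RintegralZl // mulN1r.
split.
  split; first by under eq_fun do rewrite reE.
  under eq_fun do rewrite imE.
  exact: (integrableN i2).
pose S1 j := \sum_(x <- Defs.roots (p (phi j))) (ofR2 z - x)^-1.
pose S2 j := \sum_(x <- Defs.roots (p (phi j))) (ofR2 z - x)^-1 ^+ 2.
have avgE j (f : T -> R) :
    ((phi j)%:R)^-1 * \sum_(x <- Defs.roots (p (phi j))) f (toR2 x) = avg (r j) f.
  by rewrite /avg szrt big_map.
have hS1 : ccvg (fun j => (phi j)%:R^-1 * S1 j) (cauchy_transform mu (ofR2 z)).
  split; rewrite /= ?reI ?imI ?imIE.
    rewrite [X in X @ _](_ : _ = fun j => avg (r j) (fun x =>
      cauchy_kernel (z.1 - x.1) (z.2 - x.2))) //.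
    apply/funext => j; rewrite cRe_divn cRe_sum -avgE; congr (_ * _).
    by apply: eq_bigr => x _; rewrite reE.
  rewrite [X in X @ _](_ : _ = fun j => - avg (r j) (fun x =>
    cauchy_kernel (z.2 - x.2) (z.1 - x.1))).
    exact: cvgN c2.
  apply/funext => j; rewrite cIm_divn cIm_sum -avgE -mulrN -sumrN; congr (_ * _).
  by apply: eq_bigr => x _; rewrite imE.
have hinv := inv_sq_avg_cvg0 M0 (fun j => _) v0 (fun j => (rv j).2) hd.
have {}hinv := hinv ltac:(by move=> j; rewrite szrt; exact: (hphi j).1).
have kernel_sq j : {in r j, forall x,
    cauchy_kernel (z.1 - x.1) (z.2 - x.2) ^+ 2 + cauchy_kernel (z.2 - x.2) (z.1 - x.1) ^+ 2
    = ((z.1 - x.1) ^+ 2 + (z.2 - x.2) ^+ 2)^-1}.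
  move=> x xr; have := dominates_gt0 (hd j x xr); rewrite /cauchy_kernel (addrC ((z.2 - x.2) ^+ 2)).
  by set q := _ + _ => q0; rewrite !expr_div_n -mulrDl -/q; field; rewrite gt_eqF.
(* With 1/w = s - it, the parts of (1/w)^2 are s^2 - t^2 and -2st, both bounded by s^2 + t^2 =
   1/|w|^2. *)
have sq0 (g : T -> R) : (forall x, `|g x| <=
      cauchy_kernel (z.1 - x.1) (z.2 - x.2) ^+ 2 + cauchy_kernel (z.2 - x.2) (z.1 - x.1) ^+ 2) ->
    (phi j)%:R^-1 * avg (r j) g @[j --> \oo] --> (0 : R).
  move=> hg; apply: norm_squeeze0 hinv => j; rewrite szrt normrM ger0_norm ?invr_ge0 //.
  rewrite ler_wpM2l ?invr_ge0 //; have := avgB_norm (r j) g (cst 0).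
  rewrite {2}/avg big1 // mulr0 subr0 => /le_trans; apply; apply: avg_le => x xr.
  by rewrite subr0 -(kernel_sq j x xr).
have hS2 : ccvg (fun j => (phi j)%:R^-1 * ((phi j)%:R^-1 * S2 j)) 0.
  split.
    rewrite [X in X @ _](_ : _ = fun j => (phi j)%:R^-1 * avg (r j) (fun x =>
      cauchy_kernel (z.1 - x.1) (z.2 - x.2) ^+ 2 - cauchy_kernel (z.2 - x.2) (z.1 - x.1) ^+ 2)).
      apply: sq0 => x; move: (cauchy_kernel _ _) (cauchy_kernel _ _) => s t; rewrite ler_norml.
      have := (sqr_ge0 s, sqr_ge0 t, sqr_ge0 (s + t), sqr_ge0 (s - t)).
      by move=> [[[h1 h2] h3] h4]; apply/andP; split; nra.
    apply/funext => j; rewrite !cRe_divn cRe_sum -avgE; congr (_ * (_ * _)).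
    by apply: eq_bigr => x _; rewrite expr2 cReM reE imE; ring.
  rewrite [X in X @ _](_ : _ = fun j => (phi j)%:R^-1 * avg (r j) (fun x =>
    - (2 * cauchy_kernel (z.1 - x.1) (z.2 - x.2) * cauchy_kernel (z.2 - x.2) (z.1 - x.1)))).
    apply: sq0 => x; move: (cauchy_kernel _ _) (cauchy_kernel _ _) => s t; rewrite ler_norml.
    have := (sqr_ge0 s, sqr_ge0 t, sqr_ge0 (s + t), sqr_ge0 (s - t)).
    by move=> [[[h1 h2] h3] h4]; apply/andP; split; nra.
  apply/funext => j; rewrite !cIm_divn cIm_sum -avgE; congr (_ * (_ * _)).
  by apply: eq_bigr => x _; rewrite expr2 cImM reE imE; ring.
have hN : ccvg (fun j => (phi j)%:R^-1 : C) 0.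
  split; under eq_fun do rewrite natC_inv /=; last exact: cvg_cst.
  apply: (@norm_squeeze0 _ harmonic) cvg_harmonic => j.
  by rewrite ger0_norm ?invr_ge0 //= lef_pV2 ?posrE ?ltr0n // ler_nat; exact: (hphi j).1.
have hA' := ccvg_subseq phile hA.
have hB' := ccvg_subseq phile hB.
set Z := ofR2 z in hS1 *; set K := cauchy_transform mu Z in hS1 *.
(* The termwise limit of the Riccati relation divided by n^2; [ric] shows that the sequence itself
   is identically 0. *)
have := ccvgD (ccvgD (ccvgM (ccvg_cst (1 - Z ^+ 2)) (ccvgB (ccvgM hS1 hS1) hS2))
  (ccvgM (ccvgB (ccvgB hB' hA')
    (ccvgM (ccvgD (ccvgD hA' hB') (ccvgM (ccvg_cst 2) hN)) (ccvg_cst Z))) hS1))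
  (ccvgD (ccvgD (ccvgD (ccvg_cst 1) hA') hB') hN).
have ric j : (1 - Z ^+ 2) * ((phi j)%:R^-1 * S1 j * ((phi j)%:R^-1 * S1 j) -
    (phi j)%:R^-1 * ((phi j)%:R^-1 * S2 j))
  + (beta (phi j) / (phi j)%:R - alpha (phi j) / (phi j)%:R -
     (alpha (phi j) / (phi j)%:R + beta (phi j) / (phi j)%:R + 2 * (phi j)%:R^-1) * Z) *
     ((phi j)%:R^-1 * S1 j)
  + (1 + alpha (phi j) / (phi j)%:R + beta (phi j) / (phi j)%:R + (phi j)%:R^-1) = 0.
  (* A root at [Z] would give w = 0, which [dominates_gt0] excludes. *)
  have zr : Z \notin Defs.roots (p (phi j)).
    apply/negP => zr.
    have xr : z \in r j by apply/mapP; exists Z => //; rewrite /Z /toR2 /ofR2 -surjective_pairing.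
    by have := dominates_gt0 (hd j z xr); rewrite !subrr expr0n addr0 ltxx.
  have := jacobi_riccati (sz _ (phi0 j)) zr; rewrite /= -/(S1 j) -/(S2 j).
  move: (S1 j) (S2 j) (alpha (phi j)) (beta (phi j)) (n0 j) => s1 s2 a b.
  set n : C := (phi j)%:R => nn0 e.
  apply: (mulfI (expf_neq0 2 nn0)); rewrite mulr0 -[RHS]e; field.
  exact: nn0.
under eq_fun do rewrite /= ric.
move=> /(ccvg_unique (ccvg_cst 0)) e.
rewrite [RHS]e; ring.
Unshelve. all: by end_near. Qed.
End Limit.

Theorem theorem1 (R : realType) (alpha beta : nat -> R[i]) (A B : R[i])
  (mu : probability (R * R)%type R) :
  (forall n, (1 <= n)%N -> size (jacobi n (alpha n) (beta n)) = n.+1) ->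
  ccvg (fun n => alpha n / n%:R) A ->
  ccvg (fun n => beta n / n%:R) B ->
  1 + A + B != 0 ->
  (exists K : set (R * R)%type, compact K /\ mu (~` K) = 0%E) ->
  weak_cvg (fun n => root_measure (jacobi n (alpha n) (beta n))) mu ->
  {ae (@lebesgue_measure R \x @lebesgue_measure R)%E, forall z : (R * R)%type,
     cauchy_defined mu (ofR2 z) /\
     (1 - ofR2 z ^+ 2) * cauchy_transform mu (ofR2 z) ^+ 2
       - ((A + B) * ofR2 z + A - B) * cauchy_transform mu (ofR2 z) + A + B + 1 = 0}.
Proof.
move=> sz hA hB _ _ wc.
have := ae_frequently_bounded (fun n => map (@toR2 R) (Defs.roots (jacobi n (alpha n) (beta n)))).
apply: negligibleS; apply: subsetC => z [M M0 hM]; exact: (jacobi_cauchy_eq sz hA hB wc M0 hM).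
Qed.
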